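(* Let $n\ge 1$ and $k\ge 1$ be integers, let $a_1,\dots,a_k\in\mathbb{C}$ with $a_k\neq 0$, put $$p(z)=a_k+a_{k-1}z+\dots+a_1z^{k-1}+z^k,\qquad \widehat{p}(z)=1+a_1z+\dots+a_{k-1}z^{k-1}+a_kz^k,$$ and let $O(z)=z^n\,\dfrac{p(z)}{\widehat{p}(z)}$. Write $$O'(z)=z^{n-1}\,\frac{P(z)}{\widehat{p}(z)^2},\qquad P(z)=n\,p(z)\widehat{p}(z)+z\left(p'(z)\widehat{p}(z)-p(z)\widehat{p}\,'(z)\right).$$ Then the polynomial $P(z)$ in the numerator of $O'(z)$ is palindromic.
   Context: A polynomial $A_0+A_1z+\dots+A_mz^m$ of degree $m$ is called palindromic if $A_i=A_{m-i}$ for $0\le i\le m$. *)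

(* Defs.v *)
From mathcomp Require Import all_boot all_order all_algebra.
From mathcomp Require Import complex.
From mathcomp Require Import all_classical all_reals all_analysis.

Set Implicit Arguments.
Unset Strict Implicit.
Unset Printing Implicit Defensive.

Import Order.TTheory GRing.Theory Num.Theory.
Import numFieldNormedType.Exports.

Local Open Scope ring_scope.

(* R[i] packaged as a numClosedFieldType: the normed-module structure of
   numFieldNormedType, hence is_derive, is inferred for the sort of such a
   structure but not for complex R itself. A derivative over this field in
   the direction 1 is the complex derivative. *)
Definition Cplx (R : realType) : numClosedFieldType := complex R.

(* The degree m is the exact one; the zero polynomial is not palindromic. *)
Definition palindromic (K : nzRingType) (A : {poly K}) : Prop :=
  exists m : nat, size A = m.+1 /\
    forall i : nat, (i <= m)%N -> A`_i = A`_(m - i).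

(* In the definitions below only the values a 1, ..., a k of a are used. *)
Definition pol_p (K : comNzRingType) (k : nat) (a : nat -> K) : {poly K} :=
  (\sum_(1 <= j < k.+1) a j *: 'X^(k - j)) + 'X^k.

Definition pol_phat (K : comNzRingType) (k : nat) (a : nat -> K) : {poly K} :=
  1 + \sum_(1 <= j < k.+1) a j *: 'X^j.

Definition pol_P (K : comNzRingType) (n k : nat) (a : nat -> K) : {poly K} :=
  let p := pol_p k a in
  let phat := pol_phat k a in
  n%:R * (p * phat) + 'X * (p^`() * phat - p * phat^`()).

Definition fun_O (K : fieldType) (n k : nat) (a : nat -> K) (z : K) : K :=
  z ^+ n * ((pol_p k a).[z] / (pol_phat k a).[z]).

(* Main.v *)
Require Import Defs.
From mathcomp Require Import all_boot all_order all_algebra.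
From mathcomp Require Import all_classical all_reals all_analysis.
From mathcomp Require Import ring zify.
Import Order.TTheory GRing.Theory Num.Theory.
Import numFieldNormedType.Exports.
Local Open Scope ring_scope.

(** The Euler operator [z d/dz] multiplies the coefficient of [z^i] by [i].
Writing [q = \sum_j c_j z^j] for [pol_phat] (so that [c_0 = 1]) and
[p = \sum_i b_i z^i], the polynomial [P] is therefore the double sum
[\sum_(i, j <= k) (n + i - j) b_i c_j z^(i + j)] ([numerator_double_sum]).
Here [p] is the reversal of [q], that is [b_i = c_(k - i)].  The substitution
[(i, j) -> (k - j, k - i)] keeps [n + i - j], exchanges the two factors of
[c_(k - i) c_j], and turns the exponent [i + j] into [2k - (i + j)]; hence the
coefficients of [P] in degrees [l] and [2k - l] agree
([coef_numerator_mirror]).  The constant coefficient is [n c_k c_0 = n a_k],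
nonzero, so its mirror image in degree [2k] is nonzero as well and the degree
is exactly [2k] ([size_numerator]).

The formula for the derivative is the product rule together with the quotient
rule; the factor [z^(n-1)] comes out because [z^n = z * z^(n-1)] when
[n] is positive ([is_derive_Xn_frac]). *)

Definition numerator {K : nzRingType} (n : nat) (p q : {poly K}) : {poly K} :=
  n%:R * (p * q) + 'X * (p^`() * q - p * q^`()).

Lemma mulX_deriv_poly (K : nzRingType) (m : nat) (E : nat -> K) :
  'X * (\poly_(i < m) E i)^`() = \poly_(i < m) (E i *+ i).
Proof.
apply/polyP => i; rewrite coefXM coef_deriv !coef_poly.
by case: i => [|i] /=; [rewrite mulr0n if_same | case: ifP => //; rewrite mul0rn].
Qed.

(** Distributing ['X] over the bracket turns both derivatives into Euler
operators, which act diagonally on monomials; everything else is bilinear. *)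
Lemma numerator_double_sum (K : comNzRingType) (n m : nat) (b c : nat -> K) :
  numerator n (\poly_(i < m) b i) (\poly_(i < m) c i) =
  \sum_(i < m) \sum_(j < m) ((n%:R + i%:R - j%:R) * (b i * c j)) *: 'X^(i + j).
Proof.
rewrite /numerator mulrBr (mulrA 'X) (mulrCA 'X (\poly_(i < m) b i)).
rewrite !mulX_deriv_poly !poly_def !big_distrlr /= mulr_sumr -sumrB -big_split /=.
apply: eq_bigr => i _; rewrite mulr_sumr -sumrB -big_split /=.
apply: eq_bigr => j _.
by rewrite -!mul_polyC !(rmorphM, rmorphD, rmorphN, rmorphMn) /= !polyC1 exprD; ring.
Qed.

Lemma coef_numerator (K : comNzRingType) (n m l : nat) (b c : nat -> K) :
  (numerator n (\poly_(i < m) b i) (\poly_(i < m) c i))`_l =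
  \sum_(i < m) \sum_(j < m | l == (i + j)%N)
     (n%:R + i%:R - j%:R) * (b i * c j).
Proof.
rewrite numerator_double_sum coef_sum; apply: eq_bigr => i _.
rewrite coef_sum [RHS]big_mkcond; apply: eq_bigr => j _.
by rewrite coefZ coefXn; case: eqP => _; rewrite ?mulr1 ?mulr0.
Qed.

Lemma coef_numerator_mirror (K : comNzRingType) (n k l : nat) (c : nat -> K) :
  let P := numerator n (\poly_(i < k.+1) c (k - i)%N) (\poly_(i < k.+1) c i) in
  (l <= 2 * k)%N -> P`_l = P`_(2 * k - l).
Proof.
move=> P hl; rewrite !coef_numerator.
under eq_bigr => i _ do rewrite big_mkcond.
under [RHS]eq_bigr => i _ do rewrite big_mkcond.
(* Reversing both index ranges and exchanging the two sums amounts to the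
   substitution (i, j) -> (k - j, k - i). *)
rewrite [RHS](reindex_inj rev_ord_inj) /=.
under [RHS]eq_bigr => i _ do rewrite (reindex_inj rev_ord_inj) /=.
rewrite exchange_big /=; apply: eq_bigr => j _; apply: eq_bigr => i _.
have hi : (i <= k)%N by rewrite -ltnS.
have hj : (j <= k)%N by rewrite -ltnS.
rewrite !subSS.
have -> : (2 * k - l == k - j + (k - i))%N = (l == (i + j)%N) by lia.
case: eqP => // _; rewrite (subKn hj) (natrB _ hi) (natrB _ hj).
by ring.
Qed.

(** In degree [0] only the pair [(0, 0)] contributes, giving [n c_k c_0]; by
the mirror symmetry this is also the coefficient in degree [2k], beyond which
no pair of indices reaches. *)
Lemma size_numerator (K : numDomainType) (n k : nat) (c : nat -> K) :
  (0 < n)%N -> c 0 != 0 -> c k != 0 ->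
  size (numerator n (\poly_(i < k.+1) c (k - i)%N) (\poly_(i < k.+1) c i))
    = (2 * k).+1.
Proof.
move=> hn h0 hk; set P := numerator _ _ _.
apply/eqP; rewrite eqn_leq; apply/andP; split.
  apply/leq_sizeP => l hl; rewrite coef_numerator big1 // => i _.
  rewrite big1 // => j /eqP lij.
  by have := ltn_ord i; have := ltn_ord j; lia.
suff : P`_(2 * k) != 0.
  by apply: contraR; rewrite -leqNgt => /leq_sizeP ->.
rewrite coef_numerator_mirror // subnn coef_numerator.
rewrite big_ord_recl [X in _ + X]big1 ?addr0; last first.
  by move=> i _; apply: big_pred0 => j.
rewrite (big_pred1 ord0) /= ?subn0 => [|j]; last by rewrite eq_sym.
by rewrite subr0 !mulf_neq0 // pnatr_eq0 -lt0n.
Qed.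

(** The convention [a_0 = 1], which makes [pol_phat] a uniform sum and exhibits
[pol_p] as its reversal. *)
Definition with_unit_head {K : nzRingType} (a : nat -> K) (j : nat) : K :=
  if j is 0%N then 1 else a j.

Lemma pol_phatE (K : comNzRingType) (k : nat) (a : nat -> K) :
  pol_phat k a = \poly_(i < k.+1) with_unit_head a i.
Proof.
rewrite poly_def /pol_phat big_add1 /= big_mkord big_ord_recl.
by rewrite expr0 scale1r.
Qed.

Lemma pol_pE (K : comNzRingType) (k : nat) (a : nat -> K) :
  pol_p k a = \poly_(i < k.+1) with_unit_head a (k - i).
Proof.
rewrite poly_def (reindex_inj rev_ord_inj) /pol_p big_add1 /= big_mkord.
rewrite big_ord_recl /= subn1 /= subnn scale1r addrC; congr (_ + _).
by apply: eq_bigr => i _; rewrite subSS subKn.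
Qed.

Lemma palindromic_pol_P (K : numDomainType) (n k : nat) (a : nat -> K) :
  (0 < n)%N -> (0 < k)%N -> a k != 0 -> palindromic (pol_P n k a).
Proof.
move=> hn hk hak; exists (2 * k)%N.
rewrite -[pol_P n k a]/(numerator n (pol_p k a) (pol_phat k a)).
rewrite pol_pE pol_phatE; split.
  by apply: size_numerator; rewrite //= ?oner_eq0 //; case: k hk hak.
by move=> l; apply: coef_numerator_mirror.
Qed.

(** Stated over an arbitrary [numFieldType], so that it covers complex
derivatives as well as real ones. *)
Lemma is_derive_horner (K : numFieldType) (p : {poly K}) (z : K) :
  is_derive z 1 (horner p) p^`().[z].
Proof.
elim/poly_ind: p => [|p r ih].
  have -> : horner (0 : {poly K}) = cst 0 by apply/funext => y; rewrite horner0.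
  by rewrite deriv0 horner0; exact: is_derive_cst.
have -> : horner (p * 'X + r%:P) = horner p * id + cst r.
  by apply/funext => y; rewrite !hornerE.
apply: is_derive_eq; rewrite derivD derivM derivX derivC !hornerE /GRing.scale /=.
by rewrite mulr1 addrC mulrC.
Qed.

Lemma is_derive_frac (K : numFieldType) (p q : {poly K}) (z : K) :
  q.[z] != 0 ->
  is_derive z 1 (fun y => p.[y] / q.[y])
    ((p^`() * q - p * q^`()).[z] / q.[z] ^+ 2).
Proof.
move=> qz.
have dp := is_derive_horner _ p z; have dq := is_derive_horner _ q z.
have dV : is_derive z 1 (fun y => q.[y]^-1) (- q.[z] ^- 2 *: q^`().[z]).
  apply: DeriveDef; first by apply: derivableV.
  by rewrite deriveV ?derive_val.
apply: is_derive_eq; rewrite !hornerE /GRing.scale /=.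
by field.
Qed.

Lemma is_derive_Xn_frac (K : numFieldType) (n : nat) (p q : {poly K}) (z : K) :
  (0 < n)%N -> q.[z] != 0 ->
  is_derive z 1 (fun y => y ^+ n * (p.[y] / q.[y]))
    (z ^+ n.-1 * ((numerator n p q).[z] / q.[z] ^+ 2)).
Proof.
move=> hn qz.
have dF := is_derive_frac _ p _ _ qz.
have dX := is_derive_horner _ 'X^n z.
have -> : (fun y => y ^+ n * (p.[y] / q.[y]))
          = horner 'X^n * (fun y => p.[y] / q.[y]).
  by apply/funext => y; rewrite /= !fctE hornerXn.
apply: is_derive_eq.
rewrite /numerator mulr_natl derivXn !hornerE !hornerMn !hornerE /GRing.scale /=.
case: n hn {dX} => //= n _; rewrite exprS.
by field.
Qed.

Theorem lemma2p8 (R : realType) (n k : nat) (a : nat -> Cplx R)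
    (hn : (1 <= n)%N) (hk : (1 <= k)%N) (hak : a k != 0) :
  (forall z : Cplx R, (pol_phat k a).[z] != 0 ->
     is_derive z 1 (fun_O n k a)
       (z ^+ n.-1 * ((pol_P n k a).[z] / (pol_phat k a).[z] ^+ 2)))
  /\ palindromic (pol_P n k a).
Proof.
split; last exact: palindromic_pol_P.
by move=> z qz; exact: is_derive_Xn_frac.
Qed.
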